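(* There exists a map $e:\mathscr P_\omega(\boldsymbol\beta\omega)\to\boldsymbol\beta\omega$ such that for all $X,Y\in\mathscr P_\omega(\boldsymbol\beta\omega)$: (i) if $X\subseteq Y$ then $e(X)\le_{\mathrm{RK}}e(Y)$; (ii) if $e(X)\le_{\mathrm C}e(Y)$ then $X\subseteq Y$. Consequently, for every binary relation $R$ on $\boldsymbol\beta\omega$ with ${\le_{\mathrm{RK}}}\subseteq R\subseteq{\le_{\mathrm C}}$, the map $e$ is an isomorphic embedding of the lattice $(\mathscr P_\omega(\boldsymbol\beta\omega),\subseteq)$ into the structure $(\boldsymbol\beta\omega,R)$, i.e., $e$ is injective and $X\subseteq Y$ iff $e(X)\,R\,e(Y)$.
   Context: $\boldsymbol\beta\omega$ is the set of all ultrafilters over $\omega$ (principal ones included; $n\in\omega$ is identified with the principal ultrafilter at $n$), with the topology generated by the sets $\{\mathfrak u:A\in\mathfrak u\}$, $A\subseteq\omega$; it is the Čech–Stone compactification of discrete $\omega$, and $|\boldsymbol\beta\omega|=2^{\mathfrak c}$ with $\mathfrak c=2^{\aleph_0}$. For a map $f$ of $\omega$ into a compact Hausdorff space $K$, $\widetilde f:\boldsymbol\beta\omega\to K$ is its unique continuous extension. $\mathscr P_\omega(S)$ is the set of finite subsets of $S$. Rudin–Keisler preorder: $\mathfrak u\le_{\mathrm{RK}}\mathfrak v$ iff there is $f:\omega\to\omega$ with $\widetilde f(\mathfrak v)=\mathfrak u$. Comfort preorder: a Tychonoff space $X$ is $\mathfrak u$-compact iff for every $f:\omega\to X$ one has $\widetilde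 f(\mathfrak u)\in X$, where $\widetilde f:\boldsymbol\beta\omega\to\boldsymbol\beta X$ and $\boldsymbol\beta X\supseteq X$ is the Čech–Stone compactification of $X$; $\mathfrak u\le_{\mathrm C}\mathfrak v$ iff every $\mathfrak v$-compact (Tychonoff) space is $\mathfrak u$-compact. One has ${\le_{\mathrm{RK}}}\subseteq{\le_{\mathrm C}}$. *)

(* Defs.v *)
From HB Require Import structures.
From mathcomp Require Import all_boot all_order all_algebra finmap.
From mathcomp Require Import all_classical all_reals topology normedtype.
Set Implicit Arguments.
Unset Strict Implicit.
Unset Printing Implicit Defensive.
Import Order.TTheory GRing.Theory Num.Theory.
Import numFieldNormedType.Exports.
Local Open Scope classical_set_scope.
Local Open Scope ring_scope.

Record betaomega := BetaOmega {
  ultra_sets : set_system nat;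
  ultra_setsP : UltraFilter ultra_sets }.

#[global] Existing Instance ultra_setsP.

HB.instance Definition _ := gen_eqMixin betaomega.
HB.instance Definition _ := gen_choiceMixin betaomega.

Definition basic_set (A : set nat) : set betaomega :=
  [set u | ultra_sets u A].

Lemma basic_set_cover : \bigcup_(A in [set: set nat]) basic_set A = setT.
Proof.
rewrite -subTset => u _; exists setT => //.
exact: (@filterT _ (ultra_sets u)).
Qed.

Lemma basic_set_join (A B : set nat) (u : betaomega) :
  [set: set nat] A -> [set: set nat] B -> basic_set A u -> basic_set B u ->
  exists C, [/\ [set: set nat] C, basic_set C u &
    basic_set C `<=` basic_set A `&` basic_set B].
Proof.
move=> _ _ uA uB; exists (A `&` B); split=> //; first exact: filterI.
by move=> v vAB; split; apply: filterS vAB => n [].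
Qed.

HB.instance Definition _ :=
  isBaseTopological.Build betaomega basic_set_cover basic_set_join.

Lemma nbhs_betaomegaP (u : betaomega) (U : set betaomega) :
  nbhs u U <-> exists2 A, ultra_sets u A & basic_set A `<=` U.
Proof.
rewrite nbhsE; split=> [[V [[D _ <-]] [A DA uA] VU]|[A uA AU]].
  by exists A => // v vA; apply: VU; exists A.
exists (basic_set A) => //; split=> //; exists [set A] => //.
by rewrite bigcup_set1.
Qed.

Lemma proper_filterC (T : Type) (F : set_system T) {PF : ProperFilter F}
  (A : set T) : F A -> ~ F (~` A).
Proof.
by move=> FA FnA; have [x []] := filter_ex (filterI FA FnA).
Qed.

Lemma decided_ultra (T : Type) (F : set_system T) :
  ProperFilter F -> (forall A, F A \/ F (~` A)) -> UltraFilter F.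
Proof.
move=> PF dF; split=> // G PG FG; apply/seteqP; split=> // A GA.
by have [//|/FG /(proper_filterC GA)] := dF A.
Qed.

Lemma map_ultra (T U : Type) (f : T -> U) (F : set_system T) :
  UltraFilter F -> UltraFilter (f @ F).
Proof.
move=> UF; apply: decided_ultra => A.
exact: (in_ultra_setVsetC (f @^-1` A) UF).
Qed.

Lemma betaomega_compact : compact [set: betaomega].
Proof.
rewrite compact_ultra => F UF _.
pose G : set_system nat := [set A | F (basic_set A)].
have PG : ProperFilter G.
  apply: Build_ProperFilter_ex.
    move=> A GA; have [u uA] := @filter_ex _ F _ _ GA.
    exact: (@filter_ex _ (ultra_sets u)).
  split.
  - apply: (@filterS _ F _ _ _ _ filterT) => u _.
    exact: (@filterT _ (ultra_sets u)).
  - move=> A B GA GB; apply: (@filterS _ F _ _ _ _ (@filterI _ F _ _ _ GA GB)).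
    by move=> u [uA uB]; exact: (@filterI _ (ultra_sets u)).
  - move=> A B AB; apply: (@filterS _ F) => u.
    exact: (@filterS _ (ultra_sets u)).
have UG : UltraFilter G.
  apply: decided_ultra => A.
  have [|FnA] := in_ultra_setVsetC (basic_set A) UF; first by left.
  right; apply: (@filterS _ F _ _ _ _ FnA) => u nuA.
  by have [] := in_ultra_setVsetC A (ultra_setsP u).
exists (BetaOmega UG); split=> // U /nbhs_betaomegaP[A GA AU].
exact: filterS AU GA.
Qed.

Lemma betaomega_hausdorff : hausdorff_space betaomega.
Proof.
move=> u v cuv.
suff E : ultra_sets u = ultra_sets v.
  case: u v E {cuv} => [F UF] [G UG] /= E; case: _ / E in UG *.
  by congr BetaOmega; exact: Prop_irrelevance.
have sub : ultra_sets u `<=` ultra_sets v.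
  move=> A uA; have [//|vnA] := in_ultra_setVsetC A (ultra_setsP v).
  have [||w [wA /(proper_filterC wA)//]] := cuv (basic_set A) (basic_set (~` A)).
  - by apply/nbhs_betaomegaP; exists A.
  - by apply/nbhs_betaomegaP; exists (~` A).
apply/seteqP; split=> // A vA.
by have [//|/sub /(proper_filterC vA)] := in_ultra_setVsetC A (ultra_setsP u).
Qed.

(* n in omega is identified with principal n. *)
Definition principal (n : nat) : betaomega :=
  BetaOmega (principal_filter_ultra n).

(* The continuous extension of f : omega -> K to beta omega; the default value
   is never reached when K is compact Hausdorff, see extensionP and
   betaomega_ext_unique. *)
Definition extension (K : topologicalType) (f : nat -> K) : betaomega -> K :=
  xget (fun=> f 0%N)
    [set g | continuous g /\ forall n, g (principal n) = f n].

Section extension_theory.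
Variable K : topologicalType.
Hypotheses (compactK : compact [set: K]) (hausdorffK : hausdorff_space K).

Lemma betaomega_ext_unique (g h : betaomega -> K) :
  continuous g -> continuous h ->
  (forall n, g (principal n) = h (principal n)) -> g = h.
Proof.
move=> cg ch gh; apply/funext => u; apply: hausdorffK => V W nV nW.
have gV : nbhs u (g @^-1` V) := cg u V nV.
have hW : nbhs u (h @^-1` W) := ch u W nW.
have /nbhs_betaomegaP[A uA AVW] : nbhs u (g @^-1` V `&` h @^-1` W).
  exact: filterI.
have [n An] := filter_ex uA.
have [gVn hWn] : (g @^-1` V `&` h @^-1` W) (principal n).
  by apply: AVW; exact/principal_filterP.
by exists (g (principal n)); split=> //; rewrite gh.
Qed.

Lemma extensionP (f : nat -> K) :
  continuous (extension f) /\ forall n, extension f (principal n) = f n.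
Proof.
suff [g gP] : exists g : betaomega -> K,
    continuous g /\ forall n, g (principal n) = f n.
  pose E := [set g | continuous g /\ forall n, g (principal n) = f n].
  exact: (@xgetPex _ _ E (ex_intro _ g gP)).
have /choice[g gP] (u : betaomega) : exists l : K, f @ ultra_sets u --> l.
  have UF := map_ultra f (ultra_setsP u).
  move: compactK; rewrite compact_ultra => /(_ _ UF filterT)[l [_ fl]].
  by exists l.
exists g; split=> [u U gU|n].
  have [B gB BU] :=
    @compact_regular K (g u) setT hausdorffK compactK filterT U gU.
  apply/nbhs_betaomegaP; exists (f @^-1` B); first exact: gP gB.
  move=> v vB; apply: BU => V gV.
  have fvV : ultra_sets v (f @^-1` V) := gP v V gV.
  have [n [/= Bn Vn]] := filter_ex (filterI vB fvV).
  by exists (f n).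
apply: hausdorffK => V W /(gP (principal n)) nV nW.
exists (f n); split; last exact: nbhs_singleton.
by move/principal_filterP: nV.
Qed.

End extension_theory.

Definition RK_le (u v : betaomega) : Prop :=
  exists f : nat -> nat, extension (principal \o f) v = u.

(* The Cech-Stone compactification of X, as the closure of the image of X in
   the cube indexed by the continuous functions X -> [0, 1]; stone_cech_in is
   the canonical map of X into it (an embedding with dense range when X is
   Tychonoff, see stone_cech_in_inj, nbhs_stone_cech_in and
   stone_cech_in_dense). The universal property is stone_cech_universal. *)
Section StoneCech.
Variables (R : realType) (X : topologicalType).

Definition unit_fun : Type :=
  [set h : continuousType X R | forall x, 0 <= h x <= 1].

Definition cube_eval (x : X) : prod_topology (fun _ : unit_fun => R) :=
  fun h => set_val h x.

Definition stone_cech : Type := closure (range cube_eval).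
HB.instance Definition _ := Topological.on stone_cech.

Definition stone_cech_in (x : X) : stone_cech :=
  SigSub (mem_set (subset_closure (imageT cube_eval x))).
End StoneCech.

(* By uniform_separatorP, completely_regular_space means that points and closed
   sets are separated by continuous functions into [0, 1]. *)
Definition tychonoff_space (X : topologicalType) : Prop :=
  completely_regular_space X /\ hausdorff_space X.

Lemma subtype_hausdorff (T : topologicalType) (A : set T) :
  hausdorff_space T -> hausdorff_space A.
Proof.
move=> hT p q cpq; apply: val_inj; apply: hT => V W pV qW.
have [||r [rV rW]] := cpq (set_val @^-1` V) (set_val @^-1` W).
- exact: (@initial_continuous A T set_val p).
- exact: (@initial_continuous A T set_val q).
by exists (set_val r).
Qed.

Lemma subtype_compact (T : topologicalType) (A : set T) :
  compact A -> compact [set: A].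
Proof.
rewrite !compact_ultra => cA F UF _.
have [|p [Ap Fp]] := cA _ (map_ultra set_val UF).
  by apply: (@filterS _ F _ _ _ _ filterT) => x _; exact: set_valP.
exists (SigSub (mem_set Ap)); split=> // U [_ [[V oV <-] Vp VU]].
apply: (@filterS _ F _ _ _ VU); apply: Fp; exact: open_nbhs_nbhs.
Qed.

Section StoneCechTheory.
Variable R : realType.

Local Notation cube X := (prod_topology (fun _ : unit_fun R X => R)).

Lemma cube_hausdorff (X : topologicalType) : hausdorff_space (cube X).
Proof.
apply: (@hausdorff_product _ (fun _ : unit_fun R X => R)) => _.
exact: Rhausdorff.
Qed.

Lemma closure_cube_eval_compact (X : topologicalType) :
  compact (closure (range (@cube_eval R X))).
Proof.
pose C : set (cube X) := [set p | forall h, p h \in `[0, 1] ].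
have cC : compact C.
  apply: (@tychonoff _ (fun _ : unit_fun R X => R) (fun _ => `[0,1]%classic)).
  by move=> h; exact: segment_compact.
apply: (subclosed_compact (@closed_closure _ _) cC).
rewrite [C](closure_id _).1; last exact: compact_closed (@cube_hausdorff X) cC.
apply: closureS => _ [x _ <-] h; rewrite in_itv/=; exact: (set_valP h x).
Qed.

Lemma stone_cech_compact (X : topologicalType) :
  compact [set: stone_cech R X].
Proof. exact: subtype_compact (@closure_cube_eval_compact X). Qed.

Lemma stone_cech_hausdorff (X : topologicalType) :
  hausdorff_space (stone_cech R X).
Proof. exact: subtype_hausdorff (@cube_hausdorff X). Qed.

Lemma continuous_cube (I : Type) (Y : topologicalType)
  (F : Y -> prod_topology (fun _ : I => R)) :
  (forall i, continuous (fun y => F y i)) -> continuous F.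
Proof.
move=> cF y; apply/cvg_sup => i U [_ [[V oV <-] Vy VU]].
by apply: filterS VU _; apply: (cF i y); exact: open_nbhs_nbhs.
Qed.

Lemma cube_eval_continuous (X : topologicalType) : continuous (@cube_eval R X).
Proof. by apply: continuous_cube => h; exact: (@cts_fun _ _ (set_val h)). Qed.

Lemma stone_cech_in_continuous (X : topologicalType) :
  continuous (@stone_cech_in R X).
Proof.
apply: (@continuous_comp_initial _ _ _ set_val).
exact: cube_eval_continuous.
Qed.

Lemma stone_cech_in_dense (X : topologicalType) :
  closure (range (@stone_cech_in R X)) = setT.
Proof.
rewrite -subTset => p _ U [_ [[V oV <-] Vp VU]].
have [_ [[x _ <-] Vx]] := set_valP p V (open_nbhs_nbhs (conj oV Vp)).
by exists (stone_cech_in R x); split; [exact: imageT|exact: VU].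
Qed.

Lemma nbhs_stone_cech_in (X : topologicalType) (x : X) (U : set X) :
  tychonoff_space X -> nbhs x U ->
  exists2 V, nbhs (stone_cech_in R x) V & @stone_cech_in R X @^-1` V `<=` U.
Proof.
move=> [crX _]; rewrite nbhsE => -[W [oW Wx] WU].
have /(@uniform_separatorP _ R)[f [cf f01 f0 f1]] :=
  crX x (~` W) (open_closedC oW) (fun nWx => nWx Wx).
have fP : [set h : continuousType X R | forall x, 0 <= h x <= 1] (mkcts cf).
  by move=> y; have /= := f01 _ (imageT f y); rewrite in_itv.
pose h : unit_fun R X := SigSub (mem_set fP).
exists (set_val @^-1` [set p : cube X | p h < 1]) => /=.
  apply: (@initial_continuous _ _ set_val).
  have : nbhs (f x) [set r : R | r < 1].
    apply: open_nbhs_nbhs; split; first exact: open_lt.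
    by rewrite /= (f0 (f x)) ?ltr01//; exists x.
  exact: (@proj_continuous _ (fun _ : unit_fun R X => R) h).
move=> y /= hy; apply: WU; apply: contrapT => nWy.
have fy : f y = 1 by apply: f1; exists y.
by have : f y < 1 := hy; rewrite fy ltxx.
Qed.

Lemma stone_cech_inK (K : topologicalType) :
  compact [set: K] -> hausdorff_space K -> range (@stone_cech_in R K) = setT.
Proof.
move=> cK hK; rewrite -stone_cech_in_dense; apply/closure_id.
apply: compact_closed; first exact: stone_cech_hausdorff.
apply: continuous_compact cK; apply: continuous_subspaceT.
exact: stone_cech_in_continuous.
Qed.

Lemma compact_tychonoff_space (K : topologicalType) :
  compact [set: K] -> hausdorff_space K -> tychonoff_space K.
Proof.
move=> cK hK; split=> //; apply: (@normal_completely_regular R).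
  exact: compact_normal.
exact: hausdorff_accessible.
Qed.

Section stone_cech_map.
Variables (X K : topologicalType) (g : X -> K).
Hypothesis cg : continuous g.

Lemma precomp_unit_funP (k : unit_fun R K) :
  [set h : continuousType X R | forall x, 0 <= h x <= 1]
    (mkcts (fun x => continuous_comp (@cg x) (@cts_fun _ _ (set_val k) (g x)))).
Proof. by move=> x; exact: (set_valP k (g x)). Qed.

Definition precomp_unit_fun (k : unit_fun R K) : unit_fun R X :=
  SigSub (mem_set (precomp_unit_funP k)).

Definition cube_map (p : cube X) : cube K := fun k => p (precomp_unit_fun k).

Lemma cube_map_continuous : continuous cube_map.
Proof.
apply: continuous_cube => k.
exact: (@proj_continuous _ (fun _ : unit_fun R X => R) (precomp_unit_fun k)).
Qed.

Lemma cube_map_closure (p : stone_cech R X) :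
  closure (range (@cube_eval R K)) (cube_map (set_val p)).
Proof.
move=> U /cube_map_continuous nU.
have [_ [[x _ <-] Ux]] := set_valP p _ nU.
by exists (@cube_eval R K (g x)); split; [exact: imageT|exact: Ux].
Qed.

Definition stone_cech_map (p : stone_cech R X) : stone_cech R K :=
  SigSub (mem_set (@cube_map_closure p)).

Lemma stone_cech_map_continuous : continuous stone_cech_map.
Proof.
apply: (@continuous_comp_initial _ _ _ set_val) => p.
apply: (@continuous_comp _ _ _ set_val cube_map).
  exact: (@initial_continuous _ _ set_val).
exact: cube_map_continuous.
Qed.

Lemma stone_cech_map_in (x : X) :
  stone_cech_map (stone_cech_in R x) = stone_cech_in R (g x).
Proof. exact: val_inj. Qed.

End stone_cech_map.

Lemma stone_cech_in_inj (X : topologicalType) :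
  tychonoff_space X -> injective (@stone_cech_in R X).
Proof.
move=> tX x y xy; apply: tX.2 => V W xV yW.
have [V' nV' V'V] := nbhs_stone_cech_in tX xV.
have [W' nW' W'W] := nbhs_stone_cech_in tX yW.
exists y; split; last exact: nbhs_singleton.
by apply: V'V; rewrite /= -xy; exact: nbhs_singleton.
Qed.

Lemma stone_cech_universal (X K : topologicalType) (g : X -> K) :
  compact [set: K] -> hausdorff_space K -> continuous g ->
  exists! G : stone_cech R X -> K,
    continuous G /\ forall x, G (stone_cech_in R x) = g x.
Proof.
move=> cK hK cg; have tK := compact_tychonoff_space cK hK.
have /choice[G GP] (p : stone_cech R X) :
    exists y : K, stone_cech_in R y = stone_cech_map cg p.
  have : [set: stone_cech R K] (stone_cech_map cg p) by [].
  by rewrite -(stone_cech_inK cK hK) => -[y _ yE]; exists y.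
have cG : continuous G.
  move=> p U nU; have [V nV VU] := nbhs_stone_cech_in tK nU.
  rewrite GP in nV; have nmV := @stone_cech_map_continuous _ _ _ cg p V nV.
  by apply: (@filterS _ (nbhs p) _ _ _ _ nmV) => q Vq; apply: VU; rewrite /= GP.
have Gin x : G (stone_cech_in R x) = g x.
  by apply: (@stone_cech_in_inj K tK); rewrite GP stone_cech_map_in.
exists G; split=> // H [cH Hin].
apply/funext => p; apply: hK => V W pV pW.
have nV : nbhs p (G @^-1` V) := cG p V pV.
have nW : nbhs p (H @^-1` W) := cH p W pW.
have : closure (range (@stone_cech_in R X)) p by rewrite stone_cech_in_dense.
move=> /(_ _ (@filterI _ (nbhs p) _ _ _ nV nW))[_ [[x _ <-] [GV HW]]].
by exists (g x); split; [rewrite -Gin|rewrite -Hin].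
Qed.
End StoneCechTheory.

(* The membership of the value of the extension in X is its membership in the
   image of X in stone_cech R X. *)
Definition ultra_compact (R : realType) (u : betaomega) (X : topologicalType) :=
  forall f : nat -> X,
    range (@stone_cech_in R X) (extension (@stone_cech_in R X \o f) u).

Definition comfort_le (R : realType) (u v : betaomega) : Prop :=
  forall X : topologicalType, tychonoff_space X ->
    ultra_compact R v X -> ultra_compact R u X.

(* Main.v *)
(* Call u orthogonal to v (perp u v) when, for any sequence of images f_n(v),
   some member of u belongs to none of the nonprincipal ones. This is stable
   under tensor products in v, and a nonprincipal u orthogonal to v is not
   Comfort-below v: the ultrafilters that are principal, or in the closure of
   countably many nonprincipal images of v, form a v-compact subspace of
   beta omega, hence a Tychonoff space, which contains omega but not u. So it
   suffices to find nonprincipal, pairwise orthogonal w_a, a in beta omega: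
   e(X) is then the tensor product of the w_a, a in X, in the order of a fixed
   linear order of beta omega.

   The w_a are built together in continuum many stages, keeping many rows of
   Kunen's independent linked matrix independent of the filters built so far.
   A stage is given by a sequence (f_n) and a set X of integers, and treats all
   pairs (a, b) with X in a and X not in b; any a <> b are so separated. First,
   for each n some E_n goes into all such w_a while every such f_n(w_b) is made
   principal or kept away from E_n. To do so, pick a fresh row i; the filter of
   b, with finitely many entries of other rows, may force f_n into an entry k
   of row i. Fewer than continuum many k are selected in this way, so another
   entry j is left for E_n, and b either follows the forcing (the entries of a
   row are almost disjoint) or may avoid E_n. Second, as in Kunen's construction
   of OK points, a linked row and the E_n provide uncountably many sets to put
   into w_a, of which a nonprincipal f_n(w_b) can contain only finitely many;
   so one of them is in none of the f_n(w_b). *)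

Require Import Defs.
From mathcomp Require Import all_boot all_order all_algebra finmap.
From mathcomp Require Import all_classical all_reals topology normedtype.
From mathcomp Require Import wochoice.
Set Implicit Arguments.
Unset Strict Implicit.
Unset Printing Implicit Defensive.
Import numFieldNormedType.Exports.
Local Open Scope classical_set_scope.

(** * Limits along an ultrafilter and the Comfort preorder *)

Lemma betaomega_eq (u v : betaomega) : ultra_sets u `<=` ultra_sets v -> u = v.
Proof.
move=> uv.
have E : ultra_sets u = ultra_sets v.
  apply/seteqP; split=> // A vA.
  have [//|/uv uA] := in_ultra_setVsetC A (ultra_setsP u).
  by case: (proper_filterC vA).
case: u v E {uv} => [F UF] [G UG] /= E; case: _ / E in UG *.
by congr BetaOmega; exact: Prop_irrelevance.
Qed.

(** The continuous extension in explicit form, so that membership unfolds to membership of a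
    preimage. *)
Definition push (f : nat -> nat) (u : betaomega) : betaomega :=
  BetaOmega (map_ultra f (ultra_setsP u)).

Lemma glim_ultra (g : nat -> betaomega) (v : betaomega) :
  UltraFilter [set A | ultra_sets v [set n | ultra_sets (g n) A]].
Proof.
apply: decided_ultra => [|A].
  apply: Build_ProperFilter_ex.
    move=> A vA; have [n gnA] := @filter_ex _ (ultra_sets v) _ _ vA.
    exact: (@filter_ex _ (ultra_sets (g n))).
  split=> [|A B vA vB|A B AB].
  - apply: (@filterS _ (ultra_sets v) _ _ _ _ filterT) => n _.
    exact: (@filterT _ (ultra_sets (g n))).
  - apply: (@filterS _ (ultra_sets v) _ _ _ _
      (@filterI _ (ultra_sets v) _ _ _ vA vB)) => n [gA gB].
    exact: (@filterI _ (ultra_sets (g n))).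
  - apply: (@filterS _ (ultra_sets v)) => n.
    exact: (@filterS _ (ultra_sets (g n))).
have [|vnA] := in_ultra_setVsetC [set n | ultra_sets (g n) A] (ultra_setsP v).
  by left.
right; apply: (@filterS _ (ultra_sets v) _ _ _ _ vnA) => n gnA.
by have [] := in_ultra_setVsetC A (ultra_setsP (g n)).
Qed.

(** The limit of [g] along [v], that is, the continuous extension of [g] at [v], with membership
    that unfolds. *)
Definition glim (g : nat -> betaomega) (v : betaomega) : betaomega :=
  BetaOmega (glim_ultra g v).

Lemma push_continuous (f : nat -> nat) : continuous (push f).
Proof.
move=> u U /nbhs_betaomegaP[A fuA AU]; apply/nbhs_betaomegaP.
by exists (f @^-1` A) => // v vA; apply: AU.
Qed.

Lemma extension_principal (f : nat -> nat) (u : betaomega) :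
  extension (principal \o f) u = push f u.
Proof.
have [cE pE] :=
  extensionP betaomega_compact betaomega_hausdorff (principal \o f).
have -> // : extension (principal \o f) = push f.
apply: betaomega_ext_unique betaomega_hausdorff _ _ cE (@push_continuous f) _.
move=> n; rewrite pE; apply: betaomega_eq => A /principal_filterP Afn.
exact/principal_filterP.
Qed.

Lemma RK_leE (u v : betaomega) : RK_le u v <-> exists f, u = push f v.
Proof.
by split=> -[f fE]; exists f; rewrite extension_principal // in fE *.
Qed.

Lemma extension_cvg (K : topologicalType) (f : nat -> K) (u : betaomega) :
  compact [set: K] -> hausdorff_space K ->
  f @ ultra_sets u --> extension f u.
Proof.
move=> cK hK U; have [cE pE] := extensionP cK hK f => /cE.
move=> /nbhs_betaomegaP[A uA AU]; apply: filterS uA => n An /=.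
rewrite -pE; apply: AU; exact/principal_filterP.
Qed.

Lemma extension_unique (K : topologicalType) (f : nat -> K) (u : betaomega) k :
  compact [set: K] -> hausdorff_space K ->
  f @ ultra_sets u --> k -> extension f u = k.
Proof.
move=> cK hK fk; apply: (hK) => V W nV nW.
have fV := extension_cvg cK hK nV.
exact: filter_ex (filterI fV (fk _ nW)).
Qed.

(** * Compactness along an ultrafilter for subspaces of [betaomega] *)

Section subspace.
Variables (R : realType) (Z : set betaomega).

(** Closed sets of [Z] are traces of closed sets, so separating functions restrict from the compact
    Hausdorff space [betaomega]. *)
Lemma subspace_tychonoff : tychonoff_space Z.
Proof.
split; last exact: subtype_hausdorff betaomega_hausdorff.
move=> x B cB nBx.
have [V oV VB] : open (~` B) by rewrite openC.
have [crb _] := compact_tychonoff_space R betaomega_compact betaomega_hausdorff.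
have nVx : ~ (~` V) (set_val x).
  have : (~` B) x by [].
  by rewrite -VB => /= Vx; exact.
have /(@uniform_separatorP _ R)[f [cf f01 f0 f1]] :=
  crb (set_val x) (~` V) (open_closedC oV) nVx.
apply/(@uniform_separatorP _ R); exists (f \o set_val); split.
- move=> y; apply: (@continuous_comp Z betaomega R set_val f).
    exact: (@initial_continuous Z betaomega set_val).
  exact: cf.
- by move=> _ [y _ <-]; apply: f01; exists (set_val y).
- by move=> _ [_ -> <-]; apply: f0; exists (set_val x).
- move=> _ [y By <-]; apply: f1; exists (set_val y) => //= Vy.
  have : (set_val @^-1` V) y by [].
  by rewrite VB.
Qed.

Lemma subspace_cvg (F : nat -> Z) (u : betaomega) (z : Z) :
  glim (set_val \o F) u = set_val z <-> F @ ultra_sets u --> z.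
Proof.
split=> [E U [_ [[V oV <-] Vz VU]]|Fz].
  have /nbhs_betaomegaP[A zA AV] := open_nbhs_nbhs (conj oV Vz).
  rewrite -E in zA; apply: (@filterS _ (ultra_sets u) _ _ _ _ zA) => n FnA.
  by apply: VU; exact: AV.
apply/esym/betaomega_eq => A zA.
have : nbhs z (set_val @^-1` (basic_set A)).
  apply: (@initial_continuous Z betaomega set_val z).
  by apply/nbhs_betaomegaP; exists A.
exact: Fz.
Qed.

(** [Z] embeds topologically in its Cech-Stone compactification, so a limit along [u] taken there
    lies in [Z] exactly when the sequence converges in [Z]; [subspace_cvg] then locates the limit in
    [betaomega]. *)
Lemma ultra_compact_subspace (u : betaomega) :
  ultra_compact R u Z <->
  forall g : nat -> betaomega, (forall n, Z (g n)) -> Z (glim g u).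
Proof.
have tZ := subspace_tychonoff.
split=> [uZ g Zg|uZ F].
  pose F n : Z := SigSub (mem_set (Zg n)).
  have [z _ zE] := uZ F.
  suff /subspace_cvg E : F @ ultra_sets u --> z.
    suff -> : glim g u = set_val z by exact: set_valP.
    by rewrite -E; congr glim; apply/funext.
  move=> U /(nbhs_stone_cech_in R tZ)[V nV VU].
  rewrite zE in nV.
  have FV :=
    extension_cvg (@stone_cech_compact R Z) (@stone_cech_hausdorff R Z) nV.
  by apply: (@filterS _ (ultra_sets u) _ _ _ _ FV) => n; exact: VU.
have Zlim : Z (glim (set_val \o F) u) by apply: uZ => n; exact: set_valP.
pose z : Z := SigSub (mem_set Zlim).
exists z => //; apply/esym/extension_unique.
- exact: stone_cech_compact.
- exact: stone_cech_hausdorff.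
move=> U /(@stone_cech_in_continuous R Z z).
by move/(_ : F @ ultra_sets u --> z); apply; exact/subspace_cvg.
Qed.

Lemma comfort_le_closed (u v : betaomega) : comfort_le R u v ->
  (forall g : nat -> betaomega, (forall n, Z (g n)) -> Z (glim g v)) ->
  forall g : nat -> betaomega, (forall n, Z (g n)) -> Z (glim g u).
Proof.
move=> uv /ultra_compact_subspace/(uv _ subspace_tychonoff).
by move=> /ultra_compact_subspace.
Qed.

End subspace.

(** * Smallness *)

Lemma well_order_total (T : eqType) (le : rel T) :
  well_order le -> [/\ total le, antisymmetric le & transitive le].
Proof.
move=> woW; have woC : wo_chain le predT := withinW woW.
have le_anti : antisymmetric le.
  by move=> a b; apply: (wo_chain_antisymmetric woC).
split=> // [a b|b a c ab bc]; first exact: (wo_chainW woC).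
have [|z [[]]] := woW [pred x | [|| x == a, x == b | x == c]].
  by exists a; rewrite inE eqxx.
rewrite !inE => /or3P[]/eqP -> lz _.
- by apply: lz; rewrite !inE eqxx !orbT.
- have ba : le b a by apply: lz; rewrite !inE eqxx.
  by rewrite (le_anti a b) ?ab.
- have cb : le c b by apply: lz; rewrite !inE eqxx orbT.
  by rewrite (le_anti c b) ?cb.
Qed.

Definition strict_well_order (T : Type) (lt : T -> T -> Prop) :=
  [/\ well_founded lt, forall y x z, lt x y -> lt y z -> lt x z &
      forall x y, lt x y \/ x = y \/ lt y x].

Lemma strict_well_order_exists (T : Type) :
  exists lt : T -> T -> Prop, strict_well_order lt.
Proof.
have [le woW] := well_ordering_principle {classic T}.
have [le_tot le_anti le_tr] := well_order_total woW.
exists (fun x y => ~~ le y x); split.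
- move=> x; apply: contrapT => nx.
  have [|z [[]]] := woW [pred y : {classic T} |
    `[< ~ Acc (fun x y => ~~ le y x) y >]].
    by exists x; apply: asboolT.
  move=> zP lz _; have nz : ~ Acc _ z := asboolW zP.
  apply: nz; split=> y /negP nyz.
  by apply: contrapT => ny; apply: nyz; apply: lz; exact: asboolT.
- move=> y x z yx zy; apply/negP => zx; move/negP: zy; apply.
  by have := le_tot x y; rewrite (negbTE yx) orbF; exact: le_tr zx.
- move=> x y; have := le_anti x y.
  case: (le x y); case: (le y x) => /= E; [|by auto..].
  by right; left; exact: E.
Qed.

(** Finite trees with numbers or labels at the leaves; over a set [A] of labels there are max(|A|,
    aleph_0) of them. *)
Inductive code (L : Type) :=
  Num of nat | Lab of L | Pair of code L & code L.
Arguments Num {L}.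

Section small.
Variable L : Type.
Implicit Types (A : set L) (c d : code L).

Fixpoint over A c := match c with
  | Num _ => True
  | Lab l => A l
  | Pair c d => over A c /\ over A d
  end.

Lemma overS A A' c : A `<=` A' -> over A c -> over A' c.
Proof. by move=> AA'; elim: c => //= c IHc d IHd [/IHc ? /IHd]. Qed.

(* This replaces a bound |S| <= |A| + aleph_0: it is visibly stable under the
   operations that we need, with no cardinal arithmetic. *)
Definition small (T : Type) A (S : set T) :=
  exists f : code L -> T, S `<=` f @` over A.

Lemma small_sub T A (S S' : set T) : S `<=` S' -> small A S' -> small A S.
Proof. by move=> SS' [f fS]; exists f => x /SS' /fS. Qed.

Lemma small_over T A A' (S : set T) : A `<=` A' -> small A S -> small A' S.
Proof.
move=> AA' [f fS]; exists f => x /fS[c Ac <-]; exists c => //.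
exact: overS Ac.
Qed.

Lemma small_image T T' A (g : T -> T') (S : set T) :
  small A S -> small A (g @` S).
Proof.
by move=> [f fS]; exists (g \o f) => _ [x /fS[c Ac <-] <-]; exists c.
Qed.

Lemma small1 T A (x : T) : small A [set x].
Proof. by exists (fun=> x) => _ ->; exists (Num 0). Qed.

Lemma small_nat A : small A [set: nat].
Proof.
by exists (fun c => if c is Num n then n else 0) => n _; exists (Num n).
Qed.

Lemma small_bigcup (I T : Type) (t : T) A (B : set I) (F : I -> set T) :
  small A B -> (forall i, B i -> small A (F i)) ->
  small A (\bigcup_(i in B) F i).
Proof.
move=> [b bB] FB.
have /choice[f fP] (i : I) : exists f : code L -> T,
    B i -> F i `<=` f @` over A.
  have [/FB[f fF]|nBi] := pselect (B i); first by exists f.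
  by exists (fun=> t).
exists (fun c => if c is Pair c d then f (b c) d else t) => x [i Bi /(fP i Bi)].
move=> [d Ad <-]; have [c Ac bc] := bB _ Bi.
by exists (Pair c d); rewrite ?bc.
Qed.

Lemma small_setU T A (S S' : set T) :
  small A S -> small A S' -> small A (S `|` S').
Proof.
move=> [f fS] [g gS].
exists (fun c => if c is Pair (Num n) d then if n is 0 then f d else g d
                 else f c).
move=> x [/fS[d Ad <-]|/gS[d Ad <-]]; first by exists (Pair (Num 0) d).
by exists (Pair (Num 1) d).
Qed.

Lemma small_seq (T : eqType) A (S : set T) :
  small A S -> small A [set s : seq T | forall x, x \in s -> S x].
Proof.
move=> [f fS].
exists (fix g c := if c is Pair c d then f c :: g d else [::]).
elim=> [_|x s IH sS]; first by exists (Num 0).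
have [c Ac <-] := fS _ (sS _ (mem_head _ _)).
have [|d Ad <-] := IH; first by move=> y ys; apply: sS; rewrite inE ys orbT.
by exists (Pair c d).
Qed.

Lemma small_seq_mem (T : eqType) A (s : seq T) : T -> small A [set` s].
Proof.
move=> t; exists (fun c => if c is Num n then nth t s n else t) => x /= xs.
by exists (Num (index x s)) => //; rewrite nth_index.
Qed.

End small.

(** Cantor's diagonal argument: [g] numbers the codes without labels injectively, and [D] differs
    from [f c] at the number of [c]. *)
Lemma small_set0 (L : Type) : ~ small (@set0 L) [set: set nat].
Proof.
pose g := fix g (c : code L) : GenTree.tree nat := match c with
  | Num n => GenTree.Leaf n
  | Lab _ => GenTree.Node 1 [::]
  | Pair c d => GenTree.Node 0 [:: g c; g d]
  end.
have g_inj c d : over set0 c -> over set0 d -> g c = g d -> c = d.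
  elim: c d => [n|l|c IHc d IHd] [m|m|c' d'] //= => [_ _ [->] //|].
  by move=> [Oc Od] [Oc' Od'] [/(IHc _ Oc Oc') -> /(IHd _ Od Od') ->].
move=> [f fT].
pose D : set nat :=
  [set n | forall c, over set0 c -> choice.pickle (g c) = n -> ~ f c n].
have [c Oc fc] := fT D I.
have nD : ~ D (choice.pickle (g c)).
  by move=> Dc; have := Dc c Oc erefl; rewrite fc.
apply: nD => d Od /(pcan_inj choice.pickleK)/(g_inj _ _ Od Oc) ->.
rewrite fc => Dc.
by have := Dc c Oc erefl; rewrite fc.
Qed.

(** The numerals make room for one more label: [Num 0] stands for [l], and [Num n.+1] for
    [Num n]. *)
Lemma small_add1 (L T : Type) (A : set L) (l : L) (S : set T) :
  small (A `|` [set l]) S -> small A S.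
Proof.
move=> [f fS].
pose g := fix g (c : code L) := match c with
  | Num 0 => Lab l
  | Num n.+1 => Num n
  | Lab k => Lab k
  | Pair c d => Pair (g c) (g d)
  end.
exists (f \o g) => x /fS[c cA <-].
suff [d Ad <-] : exists2 d, over A d & g d = c by exists d.
elim: c cA => [n|k [Ak|->]|c IHc d IHd [/IHc[c' Ac <-] /IHd[d' Ad <-]]].
- by exists (Num n.+1).
- by exists (Lab k).
- by exists (Num 0).
- by exists (Pair c' d').
Qed.

Lemma strict_well_order_lex (T K : Type) (ltT : T -> T -> Prop)
    (ltK : K -> K -> Prop) (r : T -> K) :
  strict_well_order ltT -> strict_well_order ltK ->
  strict_well_order (fun x y => ltK (r x) (r y) \/ r x = r y /\ ltT x y).
Proof.
move=> [wfT trT totT] [wfK trK totK]; split.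
- move=> x; move: {2}(r x) (erefl (r x)) => k; move: x.
  elim/(well_founded_ind wfK): k => k IHk.
  elim/(well_founded_ind wfT) => x IHx rx; split=> y [|[yx ltyx]].
    by move=> ryx; apply: (IHk (r y)) => //; rewrite -rx.
  by apply: IHx ltyx _; rewrite yx.
- move=> y x z [xy|[xy ltxy]] [yz|[yz ltyz]].
  + by left; exact: trK xy yz.
  + by left; rewrite -yz.
  + by left; rewrite xy.
  + by right; split; [rewrite xy|exact: trT ltxy ltyz].
- move=> x y; have [|[E|]] := totK (r x) (r y); [by auto| |by auto].
  by have [|[|]] := totT x y; auto.
Qed.

Lemma strict_well_order_min (T : Type) (lt : T -> T -> Prop) (P : set T) x :
  strict_well_order lt -> P x ->
  exists2 y, P y & forall z, lt z y -> ~ P z.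
Proof.
move=> [wf _ _]; elim/(well_founded_ind wf): x => x IH Px.
have [[y yx Py]|nP] := pselect (exists2 y, lt y x & P y); first exact: IH Py.
by exists x => // z zx Pz; apply: nP; exists z.
Qed.

(* Take the least initial segment of a well-order whose codes enumerate all
   subsets of [nat], and enumerate them along these codes ordered by rank. *)
Lemma small_enumeration : exists (I L : Type) (lt : I -> I -> Prop)
    (A : I -> set L) (f : I -> set nat),
  [/\ strict_well_order lt, forall x y, lt x y -> A x `<=` A y,
      forall x, small (A x) [set y | lt y x],
      forall x, ~ small (A x) [set: set nat] &
      forall y, exists x, f x = y].
Proof.
have [ltL woL] := strict_well_order_exists (set nat).
have [ltC woC] := strict_well_order_exists (code (set nat)).
have [wfL trL totL] := woL.
pose seg t := [set l | ltL l t].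
(* If no proper segment [seg t] has enough codes, the whole order serves as [J]. *)
have [J [Jdown Jsmall nJsmall]] : exists J : set (set nat),
    [/\ forall l m, J m -> ltL l m -> J l, small J [set: set nat] &
        forall m, J m -> ~ small (seg m) [set: set nat]].
  have [[t tP]|nP] := pselect (exists t, small (seg t) [set: set nat]).
    have [t0 t0P t0min] 
      := @strict_well_order_min _ _ (fun t => small (seg t) setT) _ woL tP.
    exists (seg t0); split=> // l m mt lm.
    exact: trL lm mt.
  exists setT; split=> // [|m _ mP]; last by apply: nP; exists m.
  by exists (fun c => if c is Lab l then l else set0) => y _; exists (Lab y).
have [m0 Jm0] : J !=set0.
  by apply/set0P/eqP => J0; rewrite J0 in Jsmall; exact: small_set0 Jsmall.
pose segc t := seg t `|` [set t].
have segcS l m : ltL l m -> segc l `<=` segc m.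
  by move=> lm k [kl|->]; left; [exact: trL kl lm|].
(* The rank [r c] bounds all labels of [c]. Ordering by rank first puts the predecessors of [c]
   among the codes over [segc (r c)], which exceeds [seg (r c)] by a single label. *)
have /choice[r rP] (c : {c | over J c}) :
    exists m, J m /\ over (segc m) (sval c).
  case: c => c /=; elim: c => [n|l|c IHc d IHd] /=.
  - by exists m0.
  - by move=> Jl; exists l; split=> //; right.
  - move=> [/IHc[m [Jm mc]] /IHd[n [Jn nd]]].
    have [/segcS mn|[E|/segcS nm]] := totL m n.
    + by exists n; do !split=> //; exact: overS mc.
    + by exists n; rewrite -{2}E; do !split=> //; rewrite -?E.
    + by exists m; do !split=> //; exact: overS nd.
have woI :
    strict_well_order (fun x y : {c | over J c} => ltC (sval x) (sval y)).
  have [wfC trC totC] := woC; split=> [|y x z|x y].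
  - move=> [c Jc]; elim/(well_founded_ind wfC): c Jc => c IH Jc.
    by split=> -[d Jd] /= dc; exact: IH.
  - exact: trC.
  - have [|[E|]] := totC (sval x) (sval y); [by auto| |by auto].
    right; left; case: x y E => c Jc [d Jd] /= E.
    by case: _ / E in Jd *; congr exist; exact: Prop_irrelevance.
have [f fP] := Jsmall.
exists {c | over J c}, (set nat), (fun x y => ltL (r x) (r y) \/
  r x = r y /\ ltC (sval x) (sval y)), (segc \o r), (f \o sval); split.
- exact: strict_well_order_lex.
- by move=> x y /= [/segcS //|[-> _]].
- move=> x; exists (fun c =>
    if pselect (over J c) is left Jc then exist _ c Jc else x).
  move=> y yx; exists (sval y).
    have [_ ry] := rP y; apply: overS ry => /=.
    by case: yx => [/segcS //|[-> _]].
  case: y yx => c Jc /= _; case: pselect => // Jc'.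
  by congr exist; exact: Prop_irrelevance.
- move=> x sx; exact: nJsmall (rP x).1 (small_add1 sx).
- by move=> y; have [c Jc fc] := fP y I; exists (exist _ c Jc).
Qed.

(** * Orthogonal ultrafilters *)

Definition nonprincipal (u : betaomega) := forall k, ~ ultra_sets u [set k].

(** Says that [push f v] is principal. *)
Definition constant_mod (v : betaomega) (f : nat -> nat) :=
  exists k, ultra_sets v (f @^-1` [set k]).

Definition perp (u v : betaomega) := forall F : nat -> nat -> nat,
  exists2 A, ultra_sets u A &
    forall m, constant_mod v (F m) \/ ~ ultra_sets v (F m @^-1` A).

Definition pair_code (n m : nat) : nat := choice.pickle (n, m).
Definition code_pair (k : nat) : nat * nat := odflt (0, 0) (choice.unpickle k).

Lemma pair_codeK n m : code_pair (pair_code n m) = (n, m).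
Proof. by rewrite /code_pair /pair_code choice.pickleK. Qed.

Lemma ultra_setsS (u : betaomega) (A B : set nat) :
  ultra_sets u A -> A `<=` B -> ultra_sets u B.
Proof. by move=> uA AB; exact: (@filterS _ (ultra_sets u) _ _ _ AB). Qed.

Lemma ultra_setsI (u : betaomega) (A B : set nat) :
  ultra_sets u A -> ultra_sets u B -> ultra_sets u (A `&` B).
Proof. exact: (@filterI _ (ultra_sets u)). Qed.

Lemma ultra_setsN0 (u : betaomega) (A : set nat) :
  ultra_sets u A -> A !=set0.
Proof. exact: (@filter_ex _ (ultra_sets u)). Qed.

Lemma ultra_setsVC (u : betaomega) (A : set nat) :
  ultra_sets u A \/ ultra_sets u (~` A).
Proof. exact: (in_ultra_setVsetC A (ultra_setsP u)). Qed.

Lemma ultra_sets0 (u : betaomega) : ~ ultra_sets u set0.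
Proof. by move=> /ultra_setsN0[]. Qed.

(* Contains every iterated limit along v starting from omega, although its
   definition needs no iteration: countable closures absorb the limits. *)
Definition reachable (v : betaomega) : set betaomega := [set u |
  (exists k, ultra_sets u [set k]) \/
  exists F : nat -> nat -> nat, forall A,
    (forall m, constant_mod v (F m) \/ ~ ultra_sets v (F m @^-1` A)) ->
    ~ ultra_sets u A].

(** If [g n] is principal for [v]-almost all [n], the limit is an image of [v] under one function
    [h]. Otherwise the sequences that witness the second clause for the various [g n] merge into one
    by pairing. *)
Lemma reachable_closed (v : betaomega) (g : nat -> betaomega) :
  (forall n, reachable v (g n)) -> reachable v (glim g v).
Proof.
move=> gv; pose P n := exists k, ultra_sets (g n) [set k].
have [vP|vnP] := ultra_setsVC v P.
  have /choice[h hP] (n : nat) : exists k, P n -> ultra_sets (g n) [set k].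
    by have [[k gk]|nP] := pselect (P n); [exists k|exists 0].
  have [[k hk]|hn] := pselect (constant_mod v h).
    left; exists k.
    apply: (@ultra_setsS v _ _ (@ultra_setsI v _ _ vP hk)) => n [Pn /= hnk].
    by have := hP _ Pn; rewrite hnk.
  right; exists (fun=> h) => A /(_ 0)[//|hA] gA; apply: hA.
  apply: (@ultra_setsS v _ _ (@ultra_setsI v _ _ vP gA)) => n [Pn /= gnA].
  by have [k [/= -> ]] := ultra_setsN0 (ultra_setsI (hP _ Pn) gnA).
right; have /choice[F FP] (n : nat) : exists F : nat -> nat -> nat, ~ P n ->
    forall A,
    (forall m, constant_mod v (F m) \/ ~ ultra_sets v (F m @^-1` A)) ->
    ~ ultra_sets (g n) A.
  by case: (gv n) => [Pn|[F FP]]; [exists (fun _ _ => 0)|exists F].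
exists (fun k => F (code_pair k).1 (code_pair k).2) => A FA gA.
have [n [nPn gnA]] := ultra_setsN0 (@ultra_setsI v _ _ vnP gA).
apply: (FP n nPn A _ gnA) => m.
by have := FA (pair_code n m); rewrite pair_codeK.
Qed.

(** [reachable v] contains the principal ultrafilters and is closed under limits along [v]. Were [w]
    Comfort-below [v], it would be closed under limits along [w], hence contain the limit [push f w]
    of principal ultrafilters, which is [u]; both clauses of [reachable] fail for [u]. *)
Lemma perp_not_comfort_le (R : realType) (u v w : betaomega) :
  nonprincipal u -> perp u v -> RK_le u w -> ~ comfort_le R w v.
Proof.
move=> + + /RK_leE[f fE]; rewrite {u}fE => npu uv.
move=> /(@comfort_le_closed R (reachable v)).
move=> /(_ (@reachable_closed v) (principal \o f)).
case=> [n|[k fk]|[F FP]].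
- by left; exists (f n); exact/principal_filterP.
- by apply: (npu k); apply: (@ultra_setsS w _ _ fk) => n /principal_filterP.
- have [A uA vA] := uv F; apply: FP vA _.
  by apply: (@ultra_setsS w _ _ uA) => n An; exact/principal_filterP.
Qed.

(** * Tensor products *)

Definition tensor (u v : betaomega) : betaomega :=
  glim (fun n => push (pair_code n) v) u.

Lemma RK_le_refl (u : betaomega) : RK_le u u.
Proof. by apply/RK_leE; exists id; apply: betaomega_eq. Qed.

Lemma RK_le_trans (v u w : betaomega) : RK_le u v -> RK_le v w -> RK_le u w.
Proof.
move=> /RK_leE[f ->] /RK_leE[g ->]; apply/RK_leE; exists (f \o g).
exact: betaomega_eq.
Qed.

Lemma RK_le_tensorl (u v : betaomega) : RK_le u (tensor u v).
Proof.
apply/RK_leE; exists (fst \o code_pair); apply: betaomega_eq => A uA.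
apply: (@ultra_setsS u _ _ uA) => n An.
apply: (@ultra_setsS v _ _ (@filterT _ (ultra_sets v) _)).
by move=> m _ /=; rewrite pair_codeK.
Qed.

Lemma RK_le_tensorr (u v : betaomega) : RK_le v (tensor u v).
Proof.
apply/RK_leE; exists (snd \o code_pair); apply: betaomega_eq => A vA.
apply: (@ultra_setsS u _ _ (@filterT _ (ultra_sets u) _)) => n _.
by apply: (@ultra_setsS v _ _ vA) => m Am /=; rewrite pair_codeK.
Qed.

Lemma RK_le_tensor2 (w u v : betaomega) :
  RK_le u v -> RK_le (tensor w u) (tensor w v).
Proof.
move=> /RK_leE[f ->]; apply/RK_leE.
exists (fun k => pair_code (code_pair k).1 (f (code_pair k).2)).
apply: betaomega_eq => A wA; apply: (@ultra_setsS w _ _ wA) => n vA.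
apply: (@ultra_setsS v _ _ vA) => m /=.
by rewrite pair_codeK.
Qed.

Lemma perp_principal (u : betaomega) k : perp u (principal k).
Proof.
move=> F; exists setT; first exact: filterT.
by move=> m; left; exists (F m k); exact/principal_filterP.
Qed.

(** The image under [F m] is a limit along [v] of the images of [w] under the sections of [F m]. If
    [v]-almost all of these are principal, it is the image of [v] under [h (m, _)], and [A] handles
    it; otherwise [B], chosen for all sections at once, does. *)
Lemma perp_tensor (u v w : betaomega) :
  perp u v -> perp u w -> perp u (tensor v w).
Proof.
move=> uv uw F.
have /choice[h hP] (mn : nat * nat) : exists k,
    constant_mod w (F mn.1 \o pair_code mn.2) ->
    ultra_sets w ((F mn.1 \o pair_code mn.2) @^-1` [set k]).
  have [[k ?]|] := pselect (constant_mod w (F mn.1 \o pair_code mn.2)).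
    by exists k.
  by exists 0.
have [A uA vA] := uv (fun m n => h (m, n)).
have [B uB wB] := uw (fun k => F (code_pair k).1 \o pair_code (code_pair k).2).
exists (A `&` B); first exact: ultra_setsI.
move=> m; pose P n := constant_mod w (F m \o pair_code n).
have [vP|vnP] := ultra_setsVC v P; last first.
  right=> FAB; have [n [nPn FnAB]] := ultra_setsN0 (@ultra_setsI v _ _ vnP FAB).
  have := wB (pair_code m n); rewrite pair_codeK => -[//|]; apply.
  by apply: (@ultra_setsS w _ _ FnAB) => l [].
have [[k hk]|hA] := vA m.
  left; exists k.
  apply: (@ultra_setsS v _ _ (@ultra_setsI v _ _ vP hk)) => n [Pn /= hmn].
  by have := hP (m, n) Pn; rewrite hmn.
right=> FAB; apply: hA.
apply: (@ultra_setsS v _ _ (@ultra_setsI v _ _ vP FAB)) => n [Pn FnAB].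
have [l [/= <-]] := ultra_setsN0 (ultra_setsI (hP (m, n) Pn) FnAB).
by case.
Qed.


(** * The embedding given by an orthogonal family *)

Section embedding.
Variables (R : realType) (w : betaomega -> betaomega).
Hypothesis w_nonprincipal : forall a, nonprincipal (w a).
Hypothesis w_perp : forall a b, a <> b -> perp (w a) (w b).

Definition tensor_seq (s : seq betaomega) : betaomega :=
  foldr (fun a => tensor (w a)) (principal 0) s.

Lemma RK_le_subseq (s t : seq betaomega) :
  subseq s t -> RK_le (tensor_seq s) (tensor_seq t).
Proof.
elim: t s => [|b t IH] [|a s] //=; try by move=> _; exact: RK_le_refl.
  move=> _; apply: RK_le_trans (RK_le_tensorr _ _).
  by apply: (IH [::]); exact: sub0seq.
case: eqP => [-> /IH|_ /IH /= ast]; first exact: RK_le_tensor2.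
exact: RK_le_trans ast (RK_le_tensorr _ _).
Qed.

Lemma RK_le_mem (a : betaomega) (s : seq betaomega) :
  a \in s -> RK_le (w a) (tensor_seq s).
Proof.
rewrite -sub1seq => /RK_le_subseq; apply: RK_le_trans.
exact: RK_le_tensorl.
Qed.

Lemma perp_tensor_seq (a : betaomega) (s : seq betaomega) :
  a \notin s -> perp (w a) (tensor_seq s).
Proof.
elim: s => [_|b s IH] /=; first exact: perp_principal.
rewrite inE negb_or => /andP[/eqP ab /IH]; apply: perp_tensor.
exact: w_perp.
Qed.

(** Sorting by a fixed order turns inclusion of sets into the subsequence relation. For [x] in [X]
    but not in [Y], [w x] is below [e X] and orthogonal to [e Y]. *)
Lemma perp_embedding : exists e : {fset betaomega} -> betaomega,
  forall X Y : {fset betaomega},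
    ((X `<=` Y)%fset -> RK_le (e X) (e Y)) /\
    (comfort_le R (e X) (e Y) -> (X `<=` Y)%fset).
Proof.
have [le woW] := well_ordering_principle betaomega.
have [le_tot le_anti le_tr] := well_order_total woW.
exists (fun X => tensor_seq (sort le X)) => X Y; split=> [XY|XY].
  apply: RK_le_subseq.
  have -> : sort le X = [seq x <- sort le Y | x \in X].
    rewrite (filter_sort le_tot le_tr); apply/perm_sortP => //.
    apply: uniq_perm; rewrite ?filter_uniq ?fset_uniq// => x.
    by rewrite mem_filter; case: (boolP (x \in X)) => // /(fsubsetP XY).
  exact: filter_subseq.
apply/fsubsetP => x xX; apply/negPn/negP => xnY.
apply: perp_not_comfort_le (@w_nonprincipal x) _ _ XY.
- by apply: perp_tensor_seq; rewrite mem_sort.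
- by apply: RK_le_mem; rewrite mem_sort.
Qed.

End embedding.

(** * The independent linked matrix *)

Section restriction.
Implicit Types (x y : set nat) (k : nat).

Definition restriction k x : k.-tuple bool := [tuple `[< x i >] | i < k].

Lemma restriction_inj (s : seq (set nat)) : exists k0, forall k, k0 <= k ->
  {in s &, injective (restriction k)}.
Proof.
have /choice[d dP] (xy : set nat * set nat) : exists i,
    xy.1 <> xy.2 -> ~ (xy.1 i <-> xy.2 i).
  have [->|xy_neq] := pselect (xy.1 = xy.2); first by exists 0.
  have /existsNP[i xyi] : ~ forall i, xy.1 i <-> xy.2 i.
    by move=> E; apply: xy_neq; apply/seteqP; split=> i /E.
  by exists i.
exists (\max_(x <- s) \max_(y <- s) d (x, y)).+1 => k k0k x y xs ys E.
apply: contrapT => /(dP (x, y)); apply => /=.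
have dk : d (x, y) < k.
  apply: leq_trans k0k; rewrite ltnS.
  apply: leq_trans (leq_bigmax_seq _ xs isT).
  exact: (leq_bigmax_seq (F := fun y => d (x, y)) _ ys isT).
have := congr1 (fun t => tnth t (Ordinal dk)) E; rewrite !tnth_mktuple /=.
move=> xyd; exact: asbool_eq_equiv xyd.
Qed.

End restriction.

(* Kunen's matrix lives on the pairs (k, f), where f maps subsets of k to sets
   of subsets of k: the entry y of row x holds those with y `&` k in
   f (x `&` k), subject to the bound n on the size of f (x `&` k). *)
Definition matrix_point :=
  {k : nat & {ffun k.-tuple bool -> {set k.-tuple bool}}}.

Definition linked_set (x : set nat) (n : nat) (y : set nat) : set nat :=
  [set m | exists2 p : matrix_point, choice.pickle p = m &
    #|tagged p (restriction _ x)| <= n /\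
    restriction _ y \in tagged p (restriction _ x)].

Lemma linked_setS x n n' y :
  n <= n' -> linked_set x n y `<=` linked_set x n' y.
Proof.
move=> nn' m [p pm [pn py]]; exists p => //; split=> //.
exact: leq_trans nn'.
Qed.

(** Once [k] is large enough for restriction to be injective on [s], a common point at level [k]
    would have more than [n] elements in a set of size at most [n]. Each of the remaining levels is
    finite. *)
Lemma linked_set_finite x n (s : seq (set nat)) : uniq s -> n < size s ->
  finite_set [set m | forall y, y \in s -> linked_set x n y m].
Proof.
move=> us ns; have [k0 k0P] := restriction_inj s.
apply: (@sub_finite_set _ _ (\bigcup_(k in `I_k0) range
  (fun f : {ffun k.-tuple bool -> {set k.-tuple bool}} =>
     choice.pickle (Tagged _ f : matrix_point)))); last first.
  by apply: bigcup_finite => // k _; apply: finite_image; exact: finite_finset.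
move=> m mP; have [[k f] fm] : exists p : matrix_point, choice.pickle p = m.
  by case: s ns us mP {k0P} => // y s _ _ /(_ y (mem_head _ _))[p]; exists p.
have fP y : y \in s -> #|f (restriction _ x)| <= n /\
    restriction _ y \in f (restriction _ x).
  move=> /mP[p]; rewrite -fm => /(pcan_inj choice.pickleK) -> //.
exists k; last by exists f.
rewrite /= ltnNge; apply/negP => /k0P injs.
have sf : size s <= #|f (restriction k x)|.
  rewrite -(size_map (restriction k)) cardE; apply: uniq_leq_size.
    by rewrite map_inj_in_uniq.
  by move=> _ /mapP[y ys ->]; rewrite mem_enum; have [] := fP y ys.
have [y ys] : exists y, y \in s.
  case: s ns {us mP k0P fP injs sf} => // y s _.
  by exists y; exact: mem_head.
by have [fn _] := fP y ys; have := leq_trans ns (leq_trans sf fn); rewrite ltnn.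
Qed.

(* A cell ((x, n), s) stands for the intersection of the sets
   [linked_set x n y], [y \in s], in the row [x]. *)
Definition cell : Type := (set nat * nat * seq (set nat))%type.

Definition proper_cells (c : seq cell) :=
  uniq [seq r.1.1 | r <- c] && all (fun r => size r.2 <= r.1.2) c.

Definition cells_meet (c : seq cell) : set nat :=
  [set m | forall r y, r \in c -> y \in r.2 -> linked_set r.1.1 r.1.2 y m].

Lemma cells_meet_infinite (c : seq cell) :
  proper_cells c -> infinite_set (cells_meet c).
Proof.
move=> /andP[uc /allP cP] fc.
have [k0 k0P] := restriction_inj [seq r.1.1 | r <- c].
pose lev m := if @choice.unpickle matrix_point m is Some p then tag p else 0.
have : finite_set (lev @` cells_meet c) by exact: finite_image.
apply: (@sub_infinite_set _ [set k | k0 <= k]); last first.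
  move=> fk; apply: infinite_nat.
  suff <- : [set k | k0 <= k] `|` `I_k0 = setT by rewrite finite_setU.
  by apply/seteqP; split=> // k _; case: (leqP k0 k) => /=; [left|right].
move=> k /= /k0P injc.
(* A common point at level [k]: [f] sends the trace of each row to the traces of its entries, which
   is consistent as the rows have distinct traces. *)
pose f : {ffun k.-tuple bool -> {set k.-tuple bool}} := [ffun t =>
  [set z in flatten [seq map (restriction k) r.2 |
     r <- c & restriction k r.1.1 == t]]]%SET.
have fE r : r \in c ->
    f (restriction k r.1.1) = [set z in map (restriction k) r.2]%SET.
  move=> rc; rewrite ffunE; suff -> : [seq r' <- c | restriction k r'.1.1 ==
      restriction k r.1.1] = [:: r] by rewrite /= cats0.
  rewrite -[RHS](filter_pred1_uniq (map_uniq uc) rc).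
  apply: eq_in_filter => r' r'c /=; apply/eqP/eqP => [|-> //].
  move=> Er; have E : r'.1.1 = r.1.1.
    by apply: injc Er; apply: (map_f (fun r : cell => r.1.1)).
  have [i ic ri] := nthP r rc; have [j jc rj] := nthP r r'c.
  have := nth_uniq (set0 : set nat) _ _ uc.
  move=> /(_ i j); rewrite !size_map => /(_ ic jc).
  rewrite !(nth_map r)// ri rj E eqxx => /esym/eqP ij.
  by rewrite -ri -rj ij.
exists (choice.pickle (existT _ k f : matrix_point)); last first.
  by rewrite /lev choice.pickleK.
move=> r y rc ys; exists (existT _ k f : matrix_point) => //=.
rewrite fE//; split.
  rewrite cardsE; apply: leq_trans (card_size _) _.
  by rewrite size_map; exact: cP.
by rewrite inE map_f.
Qed.

(** * Transfinite iteration *)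

Section states.
Variable B : Type.

(* [generators S a] generates the part of the ultrafilter [w a] built so far;
   it is grouped into data so that a small set of data may carry a large set of
   generators. The rows in [killed S] may depend on these generators. *)
Record state := State {
  data : B -> set (set (set nat));
  killed : set (set nat) }.

Implicit Types (S : state) (a b : B) (l : seq (set nat)) (c : seq cell).

Definition generators S a : set (set nat) := \bigcup_(d in data S a) d.

Definition seq_meet l : set nat := [set m | forall G, G \in l -> G m].

Definition avoids (N : set (set nat)) c := forall r, r \in c -> ~ N r.1.1.

(** Infinite rather than nonempty: finite errors may be discarded, and the cofinite sets added at
    the end. *)
Definition independent S := forall a l c,
  (forall G, G \in l -> generators S a G) -> proper_cells c ->
  avoids (killed S) c -> infinite_set (seq_meet l `&` cells_meet c).

Definition small_state (L : Type) (A : set L) S :=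
  small A (killed S) /\ small A (\bigcup_a data S a).

Definition valid (L : Type) (A : set L) S := independent S /\ small_state A S.

Definition state_le S S' :=
  (forall a, data S a `<=` data S' a) /\ killed S `<=` killed S'.

Lemma state_le_refl S : state_le S S. Proof. by split=> [a|] x. Qed.

Lemma state_le_trans S' S S'' :
  state_le S S' -> state_le S' S'' -> state_le S S''.
Proof.
move=> [D N] [D' N']; split=> [a|]; first exact: subset_trans (D' a).
exact: subset_trans N'.
Qed.

Lemma generatorsS S S' a :
  state_le S S' -> generators S a `<=` generators S' a.
Proof. by move=> [D _]; apply: bigcup_subset; exact: D. Qed.

Definition state_sup S0 (I : Type) (P : set I) (F : I -> state) := State
  (fun a => data S0 a `|` \bigcup_(i in P) data (F i) a)
  (killed S0 `|` \bigcup_(i in P) killed (F i)).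

Lemma state_sup_eq S0 (I : Type) (P : set I) (F G : I -> state) :
  (forall i, P i -> F i = G i) -> state_sup S0 P F = state_sup S0 P G.
Proof.
move=> FG; congr State; last by congr setU; apply: eq_bigcupr => i /FG ->.
by apply/funext => a; congr setU; apply: eq_bigcupr => i /FG ->.
Qed.

Lemma state_sup_ge0 S0 (I : Type) (P : set I) (F : I -> state) :
  state_le S0 (state_sup S0 P F).
Proof. by split=> [a|]; exact: subsetUl. Qed.

Lemma state_sup_ge S0 (I : Type) (P : set I) (F : I -> state) i :
  P i -> state_le (F i) (state_sup S0 P F).
Proof. by move=> Pi; split=> [a|] x Fx; right; exists i. Qed.

Lemma small_state_sup (L : Type) (A : set L) S0 (I : Type) (P : set I)
    (F : I -> state) :
  small A P -> small_state A S0 -> (forall i, P i -> small_state A (F i)) ->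
  small_state A (state_sup S0 P F).
Proof.
move=> sP [N0 D0] sF; split.
  apply: small_setU => //.
  by apply: (small_bigcup set0) => // i /sF[].
apply: (@small_sub _ _ _ _ ((\bigcup_a data S0 a) `|`
    \bigcup_(i in P) \bigcup_a data (F i) a)).
  move=> d [a _ [d0|[i Pi di]]]; first by left; exists a.
  by right; exists i => //; exists a.
apply: small_setU => //.
by apply: (small_bigcup set0) => // i /sF[].
Qed.

(** Finitely many generators of the union of a chain already occur in one member. *)
Lemma independent_sup S0 (I : Type) (P : set I) (F : I -> state) :
  independent S0 -> (forall i, P i -> independent (F i)) ->
  (forall i, P i -> state_le S0 (F i)) ->
  (forall i j, P i -> P j -> state_le (F i) (F j) \/ state_le (F j) (F i)) ->
  independent (state_sup S0 P F).
Proof.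
move=> iS0 iF S0F chF a l c lS pc ac.
have [S [iS [SS lS']]] : exists S, independent S /\
    (state_le S (state_sup S0 P F) /\ forall G, G \in l -> generators S a G).
  suff : (forall G, G \in l -> generators S0 a G) \/
      exists2 i, P i & forall G, G \in l -> generators (F i) a G.
    move=> [l0|[i Pi lFi]].
      by exists S0; split=> //; split=> //; exact: state_sup_ge0.
    by exists (F i); split; [exact: iF|split=> //; exact: state_sup_ge].
  elim: l lS => [_|G l IH lS]; first by left.
  have [|lS0|[i Pi li]] := IH.
  - by move=> G' G'l; apply: lS; rewrite inE G'l orbT.
  - have [d [d0|[i Pi di]] dG] := lS G (mem_head _ _).
      by left=> G' /[1!inE]/predU1P[->|/lS0 //]; exists d.
    right; exists i => // G' /[1!inE]/predU1P[->|/lS0]; first by exists d.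
    exact: generatorsS (S0F i Pi) _.
  - right; have [d [d0|[j Pj dj]] dG] := lS G (mem_head _ _).
      exists i => // G' /[1!inE]/predU1P[->|/li //].
      by exists d => //; exact: (S0F i Pi).1.
    have [ij|ji] := chF i j Pi Pj.
      exists j => // G' /[1!inE]/predU1P[->|/li]; first by exists d.
      exact: generatorsS ij _.
    exists i => // G' /[1!inE]/predU1P[->|/li //].
    by exists d => //; exact: ji.1.
by apply: iS lS' pc _ => r rc Nr; apply: (ac r rc); exact: SS.2.
Qed.

(** Stage [x] extends the union of the earlier stages, which is valid because there are few of them
    relative to [A x]. The last clause bounds the final state, so that the iteration can itself
    serve as a step of another one. *)
Lemma iterate (I L : Type) (lt : I -> I -> Prop) (A : I -> set L)
    (Q : I -> state -> Prop) S0 :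
  strict_well_order lt -> (forall x y, lt x y -> A x `<=` A y) ->
  (forall x, small (A x) [set y | lt y x]) -> (forall x, valid (A x) S0) ->
  independent S0 ->
  (forall x S S', state_le S S' -> Q x S -> Q x S') ->
  (forall x S, valid (A x) S ->
     exists S', [/\ state_le S S', valid (A x) S' & Q x S']) ->
  exists S, [/\ state_le S0 S, independent S, forall x, Q x S &
    forall C : set L, small C [set: I] -> (forall x, A x `<=` C) ->
      small_state C S0 -> small_state C S].
Proof.
move=> [wf tr tot] AS smallI vS0 iS0 QS step.
have /choice[next nextP] (xS : I * state) : exists S', valid (A xS.1) xS.2 ->
    [/\ state_le xS.2 S', valid (A xS.1) S' & Q xS.1 S'].
  have [/step[S' S'P]|nv] := pselect (valid (A xS.1) xS.2); first by exists S'.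
  by exists S0.
pose rec x (r : forall y, lt y x -> state) := next (x, state_sup S0
  [set y | lt y x] (fun y => if pselect (lt y x) is left h then r y h else S0)).
pose F := Fix wf (fun=> state) rec.
have FE x : F x = next (x, state_sup S0 [set y | lt y x] F).
  rewrite /F Fix_eq => [|{}x r r' rr'].
    congr (next (x, _)); apply: state_sup_eq => y /= yx.
    by case: pselect.
  congr (next (x, _)); apply: state_sup_eq => y /= yx.
  by case: pselect.
have [FP Fmon] : (forall x, valid (A x) (F x) /\ Q x (F x) /\ state_le S0 (F x))
    /\ forall x y, lt y x -> state_le (F y) (F x).
  suff FP x : [/\ valid (A x) (F x), Q x (F x), state_le S0 (F x) &
      forall y, lt y x -> state_le (F y) (F x)].
    by split=> x; have [] := FP x.
  elim/(well_founded_ind wf): x => x IH.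
  have [|le_x vx Qx] := nextP (x, state_sup S0 [set y | lt y x] F).
    split=> /=.
      apply: independent_sup => // [y /IH[[]]//|y /IH[] //|y z yx zx].
      have [yz|[->|zy]] := tot y z.
      - by left; have [_ _ _] := IH z zx; exact.
      - by left; exact: state_le_refl.
      - by right; have [_ _ _] := IH y yx; exact.
    apply: small_state_sup => //; first by case: (vS0 x).
    move=> y yx; have [[_ [sN sD]] _ _ _] := IH y yx.
    by split; apply: small_over (AS _ _ yx) _.
  rewrite -FE /= in le_x vx Qx; split=> //.
    exact: state_le_trans (state_sup_ge0 _ _ _) le_x.
  by move=> y yx; apply: state_le_trans (state_sup_ge _ _ _) le_x.
exists (state_sup S0 setT F); split.
- exact: state_sup_ge0.
- apply: independent_sup => // [x _|x _|x y _ _].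
  + by have [[]] := FP x.
  + by have [_ []] := FP x.
  have [yz|[->|zy]] := tot x y; first by left; exact: Fmon.
    by left; exact: state_le_refl.
  by right; exact: Fmon.
- move=> x; apply: QS (@state_sup_ge S0 I setT F x Logic.I) _.
  by have [_ []] := FP x.
- move=> C sC AC sS0; apply: small_state_sup => // x _.
  have [[_ [sN sD]] _] := FP x.
  by split; apply: small_over (AC x) _.
Qed.

End states.

(** * One stage of the construction *)

Section steps.
Variable B : Type.
Implicit Types (S : state B) (a b : B) (l : seq (set nat)) (c : seq cell).

Lemma seq_meet_cat l l' : seq_meet (l ++ l') = seq_meet l `&` seq_meet l'.
Proof.
apply/seteqP; split=> m.
  by move=> lm; split=> G Gl; apply: lm; rewrite mem_cat Gl ?orbT.
by move=> [lm l'm] G; rewrite mem_cat => /orP[/lm|/l'm].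
Qed.

Lemma cells_meet_cat c c' :
  cells_meet (c ++ c') = cells_meet c `&` cells_meet c'.
Proof.
apply/seteqP; split=> m.
  by move=> cm; split=> r y rc; apply: cm; rewrite mem_cat rc ?orbT.
by move=> [cm c'm] r y; rewrite mem_cat => /orP[/cm|/c'm]; exact.
Qed.

Lemma cells_meet1 x n s : cells_meet [:: (x, n, s)] =
  [set m | forall y, y \in s -> linked_set x n y m].
Proof.
apply/seteqP; split=> m cm => [y ys|r y].
  exact: (cm (x, n, s) y (mem_head _ _)).
by rewrite inE => /eqP ->; exact: cm.
Qed.

Lemma proper_cells_cat c c' : proper_cells c -> proper_cells c' ->
  (forall r, r \in c -> r.1.1 \notin [seq r'.1.1 | r' <- c']) ->
  proper_cells (c ++ c').
Proof.
move=> /andP[uc szc] /andP[uc' szc'] cc'.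
rewrite /proper_cells map_cat cat_uniq uc uc' all_cat szc szc' !andbT /=.
apply/hasPn => _ /mapP[r rc' ->]; apply/negP => /mapP[r' /cc'/negP + E].
by apply; rewrite -E; exact: (map_f (fun r : cell => r.1.1)).
Qed.

Lemma avoids_cat N c c' : avoids N c -> avoids N c' -> avoids N (c ++ c').
Proof. by move=> ac ac' r; rewrite mem_cat => /orP[/ac|/ac']. Qed.

Lemma avoids_sub (N N' : set (set nat)) c :
  N `<=` N' -> avoids N' c -> avoids N c.
Proof. by move=> NN' ac r rc /NN'; exact: ac. Qed.

Lemma independent_extend S S' (W : B -> set (set nat)) :
  (forall a, generators S' a `<=` generators S a `|` W a) ->
  (forall a l l' c, (forall G, G \in l -> generators S a G) ->
     (forall G, G \in l' -> W a G) -> proper_cells c -> avoids (killed S') c ->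
     infinite_set (seq_meet l `&` seq_meet l' `&` cells_meet c)) ->
  independent S'.
Proof.
move=> S'W iW a l c lS' pc ac.
pose isS G := `[< generators S a G >].
have lS G : G \in [seq G <- l | isS G] -> generators S a G.
  by rewrite mem_filter => /andP[/asboolP].
have lW G : G \in [seq G <- l | ~~ isS G] -> W a G.
  by rewrite mem_filter => /andP[/asboolP nSG /lS' /S'W[]].
apply: sub_infinite_set (iW a _ _ c lS lW pc ac) => m [[lm l'm] cm].
split=> // G Gl; case: (boolP (isS G)) => SG.
  by apply: lm; rewrite mem_filter SG.
by apply: l'm; rewrite mem_filter SG.
Qed.

Lemma small_neq (L : Type) (A : set L) (N : set (set nat)) :
  ~ small A [set: set nat] -> small A N -> exists x, ~ N x.
Proof.
move=> nA sN; apply: contrapT => /forallNP nN; apply: nA.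
by apply: small_sub sN => x _; apply: contrapT; exact: nN.
Qed.

(** In the last alternative, an image under [f] that contains [E] contains a finite set, hence is
    principal. *)
Definition separated S (P : set B) (f : nat -> nat) (E : set nat) :=
  (forall a, P a -> generators S a E) /\
  forall b, ~ P b -> generators S b (f @^-1` (~` E)) \/
    exists2 G, finite_set (E `&` G) & generators S b (f @^-1` G).

Lemma separatedS S S' P f E :
  state_le S S' -> separated S P f E -> separated S' P f E.
Proof.
move=> SS' [PE nPE]; split=> [a /PE|b /nPE[|[G EG]]].
- exact: generatorsS.
- by left; exact: generatorsS SS' _ _.
- by right; exists G => //; exact: generatorsS SS' _ _.
Qed.

Lemma step_separate (L : Type) (A : set L) (P : set B) (f : nat -> nat) S :
  ~ small A [set: set nat] -> valid A S ->
  exists S', [/\ state_le S S', valid A S' & exists E, separated S' P f E].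
Proof.
move=> nA [iS [sN sD]].
have [i Ni] := small_neq nA sN.
pose D := \bigcup_a data S a.
(* The finitely many data p and the cells c force f into the entry k. One k is
   selected for each p, so that few entries are excluded. *)
pose forces (p : seq (set (set nat))) k l c := [/\
  forall G, G \in l -> exists2 d, d \in p & d G,
  proper_cells c, avoids (killed S) c &
  finite_set (seq_meet l `&` cells_meet c `&` f @^-1` (~` linked_set i 1 k))].
have /choice[kc kcP] (p : seq (set (set nat))) : exists kc : set nat * seq cell,
    (exists k l c, forces p k l c) -> exists l, forces p kc.1 l kc.2.
  have [[k [l [c fp]]]|nfp] := pselect (exists k l c, forces p k l c).
    by exists (k, c) => _; exists l.
  by exists (set0, [::]).
have sp : small A [set p : seq (set (set nat)) | forall d, d \in p -> D d].
  exact: small_seq.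
(* The entry [j] differs from all those selected for finite sequences of data. *)
have [j jP] := small_neq nA (small_image (fun p => (kc p).1) sp).
pose E := linked_set i 1 j.
(* [Q a] is the only new generator for [a]. Outside [P], it follows the forcing if the data of [a]
   force some entry, and avoids [E] otherwise. *)
have /choice[Q QP] (a : B) : exists Q, [\/ P a /\ Q = E,
    ~ P a /\ (exists p, [/\ forall d, d \in p -> data S a d,
      exists k l c, forces p k l c & Q = f @^-1` linked_set i 1 (kc p).1]) |
    [/\ ~ P a, forall p, (forall d, d \in p -> data S a d) ->
      ~ exists k l c, forces p k l c & Q = f @^-1` (~` E)]].
  have [Pa|nPa] := pselect (P a); first by exists E; apply: Or31.
  have [[p [pa fp]]|np] := pselect (exists p,
      (forall d, d \in p -> data S a d) /\ exists k l c, forces p k l c).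
    exists (f @^-1` linked_set i 1 (kc p).1); apply: Or32; split=> //.
    by exists p.
  exists (f @^-1` (~` E)); apply: Or33; split=> // p pa fp.
  by apply: np; exists p.
pose rows p := [set` [seq r.1.1 | r <- (kc p).2]].
pose S' := State (fun a => data S a `|` [set [set Q a]])
  (killed S `|` [set i] `|`
   \bigcup_(p in [set p : seq (set (set nat)) |
     forall d, d \in p -> D d]) rows p).
have SS' : state_le S S'.
  by split=> [a d|x] ?; [left|left; left].
have S'Q a : generators S' a `<=` generators S a `|` [set Q a].
  by move=> G [d [Sd|->]] dG; [left; exists d|right].
have QS' a : generators S' a (Q a) by exists [set Q a] => //; right.
have avS c : avoids (killed S') c -> avoids (killed S) c.
  exact: avoids_sub SS'.2.
have iS' : independent S'.
  apply: independent_extend S'Q _ => a l l' c la l'Q pc ac.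
  have l'Qa : Q a `<=` seq_meet l' by move=> m Qm G /l'Q ->.
  suff : infinite_set (seq_meet l `&` Q a `&` cells_meet c).
    by apply: sub_infinite_set => m [[lm /l'Qa l'm] cm].
  have [[Pa ->]|[nPa [p [pa /kcP[lp [lpp pcp acp fp]] ->]]]|[nPa np ->]] :=
    QP a.
  - have pc' : proper_cells ([:: (i, 1, [:: j])] ++ c).
      apply: proper_cells_cat => // r /[1!inE] /eqP -> /=.
      by apply/negP => /mapP[r' /ac + E']; apply; left; right.
    have ac' : avoids (killed S) ([:: (i, 1, [:: j])] ++ c).
      apply: avoids_cat; last exact: avS.
      by move=> r /[1!inE] /eqP ->.
    have := iS a l _ la pc' ac'; rewrite cells_meet_cat cells_meet1.
    apply: sub_infinite_set => m [lm [jm cm]].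
    by split=> //; split=> //; apply: jm; rewrite inE.
  (* The rows of the selected cells are now killed, so these cells can be joined to [c]; what leaves
     the forced entry is finite. *)
  - have lpa G : G \in lp -> generators S a G.
      by move=> /lpp[d /pa ad dG]; exists d.
    have la' G : G \in l ++ lp -> generators S a G.
      by rewrite mem_cat => /orP[/la|/lpa].
    have pc' : proper_cells (c ++ (kc p).2).
      apply: proper_cells_cat => // r /ac nr; apply/negP => rp; apply: nr.
      by right; exists p => // d /pa ad; exists a.
    have ac' : avoids (killed S) (c ++ (kc p).2).
      by apply: avoids_cat => //; exact: avS.
    apply: sub_infinite_set (infinite_setD (iS a _ _ la' pc' ac') fp) => m.
    rewrite seq_meet_cat cells_meet_cat => -[[[lm lpm] [cm cpm]] nm].
    by do !split=> //; apply: contrapT => jm; apply: nm.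
  (* Were this meet finite, data [p] that carry [l] would force [f] into the entry [j]. *)
  - move=> fin; have [p [pa lp]] : exists p : seq (set (set nat)),
        (forall d, d \in p -> data S a d) /\
        forall G, G \in l -> exists2 d, d \in p & d G.
      elim: l la {l'Q fin} => [_|G l IH la]; first by exists [::].
      have [|p [pa lp]] := IH.
        by move=> G' G'l; apply: la; rewrite inE G'l orbT.
      have [d ad dG] := la G (mem_head _ _); exists (d :: p); split.
        by move=> d' /[1!inE]/predU1P[->|/pa].
      move=> G' /[1!inE]/predU1P[->|/lp[d' d'p]].
        by exists d; rewrite ?mem_head.
      by exists d' => //; rewrite inE d'p orbT.
    apply: (np p pa); exists j, l, c; split=> //; first exact: avS.
    by apply: sub_finite_set fin => m [[lm cm] fm].
exists S'; split=> //.
  split=> //; split.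
    apply: small_setU; first by apply: small_setU => //; exact: small1.
    by apply: (small_bigcup set0) => // p _; exact: small_seq_mem set0.
  apply: (@small_sub _ _ _ _ (D `|` (fun G => [set G]) @`
      ([set E; f @^-1` (~` E)] `|` (fun p => f @^-1` linked_set i 1 (kc p).1) @`
        [set p : seq (set (set nat)) | forall d, d \in p -> D d]))).
    move=> d [a _ [ad|->]]; first by left; exists a.
    right; exists (Q a) => //.
    have [[_ ->]|[_ [p [pa _ ->]]]|[_ _ ->]] := QP a; first by left; left.
      by right; exists p => // d' /pa; exists a.
    by left; right.
  apply: small_setU => //; apply: small_image; apply: small_setU.
    by apply: small_setU; exact: small1.
  exact: small_image.
exists E; split=> [a Pa|b nPb].
  by have := QS' a; have [[_ ->]|[]|[]] := QP a.
have := QS' b.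
have [[]|[_ [p [pb _ ->]]]|[_ _ ->]] := QP b => // Qb; last by left.
right; exists (linked_set i 1 (kc p).1) => //.
have jk : j != (kc p).1.
  by apply/eqP => jk; apply: jP; exists p => // d /pb; exists b.
apply: sub_finite_set
  (linked_set_finite i (_ : uniq [:: j; (kc p).1]) (ltnSn 1)).
  by move=> m [jm km] y; rewrite !inE => /orP[]/eqP ->.
by rewrite /= inE jk.
Qed.

(* As row i is n-linked on its n-th column, an ultrafilter that omits E m and
   is nonprincipal contains at most m of these sets. *)
Definition ok_set (E : nat -> set nat) (i y : set nat) : set nat :=
  [set m | forall n, (forall n', n' < n -> E n' m) -> ~ E n m ->
     linked_set i n y m].

(** The sets [E n], [n < k], and [k] entries in column [k] of row [i] meet inside the corresponding
    [k] sets [ok_set E i y]: the first [E n] omitting such a point has [n >= k]. All these sets form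
    the single datum [W], which keeps the state small. *)
Lemma step_ok (L : Type) (A : set L) (P : set B) (E : nat -> set nat) S :
  ~ small A [set: set nat] -> valid A S ->
  (forall a n, P a -> generators S a (E n)) ->
  exists S', [/\ state_le S S', valid A S' &
    exists i, forall a y, P a -> generators S' a (ok_set E i y)].
Proof.
move=> nA [iS [sN sD]] PE; have [i Ni] := small_neq nA sN.
pose W := range (ok_set E i).
pose S' := State (fun a => data S a `|` [set d | P a /\ d = W])
  (killed S `|` [set i]).
have SS' : state_le S S' by split=> [a|]; exact: subsetUl.
exists S'; split=> //; last first.
  by exists i => a y Pa; exists W; [right|exists y].
split; last split.
- apply: (@independent_extend S _ (fun a => [set G | P a /\ W G])) => [a|].
    by move=> G [d [Sd|[Pa ->]]] dG; [left; exists d|right].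
  move=> a l l' c la l'W pc ac.
  have [Pa|nPa] := pselect (P a); last first.
    have -> : l' = [::].
      case: l' l'W => // G l' /(_ G (mem_head _ _)) [Pa _]; by [].
    have := iS a l c la pc (avoids_sub SS'.2 ac); apply: sub_infinite_set.
    by move=> m [].
  have [s l's] : exists s : seq (set nat),
      forall G, G \in l' -> exists2 y, y \in s & G = ok_set E i y.
    elim: l' l'W => [_|G l' IH l'W]; first by exists [::].
    have [|s sP] := IH.
      by move=> G' G'l; apply: l'W; rewrite inE G'l orbT.
    have [_ [y _ <-]] := l'W G (mem_head _ _); exists (y :: s).
    move=> G' /[1!inE]/predU1P[->|/sP[y' y's ->]].
      by exists y; rewrite ?mem_head.
    by exists y' => //; rewrite inE y's orbT.
  pose k := size s.
  have la' G : G \in l ++ mkseq E k -> generators S a G.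
    by rewrite mem_cat => /orP[/la //|/mapP[n _ ->]]; exact: PE.
  have pc' : proper_cells ([:: (i, k, s)] ++ c).
    apply: proper_cells_cat => // [|r /[1!inE]/eqP -> /=].
      by rewrite /proper_cells /= leqnn.
    by apply/negP => /mapP[r' /ac + E']; apply; right.
  have ac' : avoids (killed S) ([:: (i, k, s)] ++ c).
    apply: avoids_cat; last exact: avoids_sub SS'.2 ac.
    by move=> r /[1!inE] /eqP ->.
  have := iS a _ _ la' pc' ac'; rewrite cells_meet_cat cells_meet1 seq_meet_cat.
  apply: sub_infinite_set => m [[lm Em] [sm cm]].
  split=> //; split=> // G /l's[y ys ->] n En nEn.
  apply: linked_setS (sm y ys); rewrite leqNgt; apply/negP => nk.
  by apply: nEn; apply: Em; apply: map_f; rewrite mem_iota.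
- by apply: small_setU => //; exact: small1.
- apply: (@small_sub _ _ _ _ ((\bigcup_a data S a) `|` [set W])).
    by move=> d [a _ [ad|[_ ->]]]; [left; exists a|right].
  by apply: small_setU => //; exact: small1.
Qed.

Definition handled S (P : set B) (F : nat -> nat -> nat) :=
  exists E i, (forall n, separated S P (F n) (E n)) /\
    forall a y, P a -> generators S a (ok_set E i y).

Lemma handledS S S' P F : state_le S S' -> handled S P F -> handled S' P F.
Proof.
move=> SS' [E [i [sE okE]]]; exists E, i; split=> [n|a y Pa].
  exact: separatedS SS' _.
exact: generatorsS SS' _ (okE a y Pa).
Qed.

Lemma strict_well_order_nat : strict_well_order (fun m n : nat => m < n).
Proof.
split=> [n|m n p|m n]; last by case: (ltngtP m n); auto.
  by elim/ltn_ind: n => n IH; split.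
exact: ltn_trans.
Qed.

(** An inner iteration along [nat] separates each [F n]; [step_ok] is then applied to the resulting
    sets. *)
Lemma step_handle (L : Type) (A : set L) (P : set B) F S :
  ~ small A [set: set nat] -> valid A S ->
  exists S', [/\ state_le S S', valid A S' & handled S' P F].
Proof.
move=> nA vS.
have [||||||T [ST iT sepT smT]] := @iterate B nat L _ (fun=> A)
    (fun n S => exists E, separated S P (F n) E) S strict_well_order_nat.
- by move=> m n _ x.
- by move=> n; apply: small_sub (small_nat A).
- by [].
- by case: vS.
- by move=> n S1 S2 S12 [E sE]; exists E; exact: separatedS sE.
- by move=> n S1 vS1; exact: step_separate.
have {sepT}/choice[E sE] := sepT.
have vT : valid A T 
  by split=> //; exact: smT (small_nat A) (fun _ _ h => h) vS.2.
have [|T' [TT' vT' [i iP]]] := @step_ok L A P E T nA vT.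
  by move=> a n Pa; exact: (sE n).1.
exists T'; split=> //; first exact: state_le_trans TT'.
by exists E, i; split=> // n; exact: separatedS (sE n).
Qed.

End steps.

(** * The family of ultrafilters *)

Lemma ultra_sets_finite (u : betaomega) (A : set nat) :
  finite_set A -> ultra_sets u A -> exists k, ultra_sets u [set k].
Proof.
move=> /finite_seqP[s ->] {A}; elim: s => [|x s IH] us.
  by case: (@ultra_sets0 u); apply: ultra_setsS us _.
have [ux|unx] := ultra_setsVC u [set x]; first by exists x.
apply: IH; apply: ultra_setsS (ultra_setsI us unx) _ => k [/= + kx].
by rewrite inE => /predU1P[].
Qed.

(** A set of integers codes the graph of [F] and the set [X] in disjoint parts, so the enumeration
    of all subsets of [nat] runs through all tasks. *)
Lemma code_task : exists task : set nat -> (nat -> nat -> nat) * set nat,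
  forall t, exists x, task x = t.
Proof.
pose cf (n k m : nat) := choice.pickle (inl (n, k, m) : nat * nat * nat + nat).
pose cx (m : nat) := choice.pickle (inr m : nat * nat * nat + nat).
exists (fun x =>
  (fun n k => xget 0 [set m | x (cf n k m)], [set m | x (cx m)])).
move=> [F X].
exists [set p | (exists n k, p = cf n k (F n k)) \/ exists2 m, X m & p = cx m].
congr pair.
  apply/funext => n; apply/funext => k; apply: xget_unique.
    by left; exists n, k.
  move=> m [[n' [k' /(pcan_inj choice.pickleK)[-> -> ->]]] //|].
  by move=> [m' _ /(pcan_inj choice.pickleK)].
apply/seteqP; split=> m; last by move=> Xm; right; exists m.
move=> [[n [k /(pcan_inj choice.pickleK)]]//|].
by move=> [m' Xm' /(pcan_inj choice.pickleK)[->]].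
Qed.

(** By independence, the generators for [a] and the cofinite sets generate a proper filter; any
    ultrafilter above it is nonprincipal. *)
Lemma independent_ultra (S : state betaomega) : independent S ->
  exists w : betaomega -> betaomega, forall a, nonprincipal (w a) /\
    generators S a `<=` ultra_sets (w a).
Proof.
move=> iS; suff /choice[w wP] (a : betaomega) : exists u,
    nonprincipal u /\ generators S a `<=` ultra_sets u by exists w.
pose F : set_system nat := [set G | exists l,
  (forall G, G \in l -> generators S a G) /\ finite_set (seq_meet l `\` G)].
have PF : ProperFilter F.
  apply: Build_ProperFilter_ex.
    move=> G [l [la lG]]; have := iS a l [::] la erefl _.
    move=> /(_ _)/infinite_setD/(_ lG) inf.
    have [|m [[lm _] nlG]] := infinite_setN0 (inf _) => //.
    by exists m; apply: contrapT => nG; apply: nlG.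
  split.
  - by exists [::]; split=> //; rewrite setDT.
  - move=> G H [l [la lG]] [k [ka kH]]; exists (l ++ k); split=> [K|].
      by rewrite mem_cat => /orP[/la|/ka].
    apply: (@sub_finite_set _ _ ((seq_meet l `\` G) `|` (seq_meet k `\` H))).
      rewrite seq_meet_cat => m [[lm km] nGH].
      have [Gm|nGm] := pselect (G m); last by left.
      by right; split=> // Hm; apply: nGH.
    by rewrite finite_setU.
  - move=> G H GH [l [la lG]]; exists l; split=> //.
    by apply: sub_finite_set lG => m [lm nH]; split=> // /GH.
have [U [UU FU]] := ultraFilterLemma PF.
exists (BetaOmega UU); split=> [k|G SG] /=.
  have : U (~` [set k]).
    apply: FU; exists [::]; split=> //.
    by apply: sub_finite_set (finite_set1 k) => m [_ /contrapT].
  by move=> nk Uk; exact: proper_filterC nk.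
apply: FU; exists [:: G]; split=> [H /[1!inE] /eqP -> //|].
apply: sub_finite_set (finite_set0 nat) => m [lm]; apply.
by apply: lm; rewrite inE.
Qed.

Lemma handled_perp (S : state betaomega) (u v : betaomega) (a b : betaomega)
    (P : set betaomega) (F : nat -> nat -> nat) :
  generators S a `<=` ultra_sets u -> generators S b `<=` ultra_sets v ->
  P a -> ~ P b -> handled S P F ->
  exists2 A, ultra_sets u A &
    forall m, constant_mod v (F m) \/ ~ ultra_sets v (F m @^-1` A).
Proof.
move=> Su Sv Pa nPb [E [i [sE okE]]].
have constP m G : finite_set G -> ultra_sets v (F m @^-1` G) ->
    constant_mod v (F m).
  exact: (@ultra_sets_finite (push (F m) v)).
have vE m : ~ constant_mod v (F m) -> ultra_sets v (F m @^-1` (~` E m)).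
  move=> ncm; have [//|vEm] := ultra_setsVC v (F m @^-1` (~` E m)).
  have [_ /(_ b nPb)[/Sv //|[G EG /Sv vG]]] := sE m.
  case: ncm; apply: constP EG _; apply: ultra_setsS (ultra_setsI vEm vG) _.
  by move=> n [/= /contrapT].
pose Y m := [set y | ~ constant_mod v (F m) /\
  ultra_sets v (F m @^-1` ok_set E i y)].
have finY m : finite_set (Y m).
  apply: contrapT => /(@infinite_set_fset _ _ m.+1)[s sY ms].
  (* Given [m.+1] members of [Y m], the image of [v] contains their [ok_set]s and omits [E m]. The
     first omitted [E k] has [k <= m], so [m.+1] entries of column [m] contain such a point, and
     their meet is finite. *)
  have ncm : ~ constant_mod v (F m).
    by case: (fset_0Vmem s) ms => [->|[y /sY[]]].
  apply: (ncm); apply: constP (linked_set_finite i (fset_uniq s) ms) _.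
  have : ultra_sets v (F m @^-1`
      [set k | forall y, y \in enum_fset s -> ok_set E i y k]).
    have : {subset enum_fset s <= s} by [].
    elim: (enum_fset s) => [_|y t IH ys].
      exact: (ultra_setsS (@filterT _ (ultra_sets v) _)).
    have [_ vy] : Y m y by apply: sY; apply: ys; exact: mem_head.
    have vt := IH (fun z zt => ys z (mem_behead (s := y :: t) zt)).
    apply: ultra_setsS (ultra_setsI vy vt) _ => n [yn tn] z.
    by rewrite inE => /predU1P[->|/tn].
  move=> vs.
  apply: ultra_setsS (ultra_setsI vs (vE m ncm)) _ => n [okn nEn] y ys.
  have exn : exists k, ~~ `[< E k (F m n) >] by exists m; exact/asboolPn.
  case: (ex_minnP exn) => k /asboolPn nEk kmin.
  apply: (@linked_setS _ k); first by apply: kmin; exact/asboolPn.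
  apply: (okn y ys) nEk => k' kk'; apply: contrapT => /asboolPn /kmin.
  by rewrite leqNgt kk'.
(* A countable union of finite sets does not exhaust the subsets of [nat]. *)
have [y nY] : exists y, ~ (\bigcup_m Y m) y.
  apply: small_neq (@small_set0 nat) _.
  apply: (small_bigcup set0) (small_nat _) _ => m _.
  by have /finite_seqP[s ->] := finY m; exact: small_seq_mem set0.
exists (ok_set E i y); first by apply: Su; exact: okE.
move=> m; have [cm|ncm] := pselect (constant_mod v (F m)); first by left.
by right=> vy; apply: nY; exists m.
Qed.

(** For [a <> b] and a sequence [F], pick [X] in [a] but not in [b]; the stage with task [(F, X)]
    ensures the required separation. *)
Lemma perp_family : exists w : betaomega -> betaomega,
  (forall a, nonprincipal (w a)) /\ forall a b, a <> b -> perp (w a) (w b).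
Proof.
have [I [L [lt [A [f [wo AS smallI nsmall fP]]]]]] := small_enumeration.
have [task taskP] := code_task.
pose P (x : I) : set betaomega := fun a => ultra_sets a (task (f x)).2.
pose S0 : state betaomega := State (fun=> set0) set0.
have iS0 : independent S0.
  move=> a l c la pc _; have -> : l = [::].
    by case: l la => // G l /(_ G (mem_head _ _))[].
  by apply: sub_infinite_set (cells_meet_infinite pc) => m.
have vS0 x : valid (A x) S0.
  by split=> //; split; exists (fun=> set0) => y //= [].
have [||S [_ iS hS _]] := @iterate _ I L lt A
    (fun x S => handled S (P x) (task (f x)).1) S0 wo AS smallI vS0 iS0.
- by move=> x S S'; exact: handledS.
- by move=> x S; apply: step_handle; exact: nsmall.
have [w wP] := independent_ultra iS.
exists w; split=> [a|a b ab F]; first by have [] := wP a.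
have [X aX bX] : exists2 X, ultra_sets a X & ~ ultra_sets b X.
  apply: contrapT => nX; apply: ab; apply: betaomega_eq => X aX.
  by apply: contrapT => bX; apply: nX; exists X.
have [t tE] := taskP (F, X); have [x xE] := fP t.
have := hS x; rewrite /P xE tE /=.
exact: handled_perp (wP a).2 (wP b).2 aX bX.
Qed.

Theorem theorem3 (R : realType) :
  exists e : {fset betaomega} -> betaomega,
    (forall X Y : {fset betaomega},
       ((X `<=` Y)%fset -> RK_le (e X) (e Y)) /\
       (comfort_le R (e X) (e Y) -> (X `<=` Y)%fset)) /\
    (forall S : betaomega -> betaomega -> Prop,
       (forall u v : betaomega, RK_le u v -> S u v) ->
       (forall u v : betaomega, S u v -> comfort_le R u v) ->
       injective e /\
       forall X Y : {fset betaomega}, (X `<=` Y)%fset <-> S (e X) (e Y)).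
Proof.
have [w [w_np w_perp]] := perp_family.
have [e eP] := perp_embedding R w_np w_perp.
exists e; split=> // S RKS SC.
have SP X Y : (X `<=` Y)%fset <-> S (e X) (e Y).
  by split=> [/(eP X Y).1/RKS|/SC/(eP X Y).2].
split=> // X Y E; apply/eqP; rewrite eqEfsubset.
by apply/andP; split; apply/SP; rewrite E; apply: RKS; exact: RK_le_refl.
Qed.
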